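(* Suppose $\psi''$ is increasing (i.e. non-decreasing) and log-convex on $\Theta$ (so that necessarily $B=\infty$). Then each $(s,t)\in(A,B)^2$ with $s\le t$ belongs to $\Omega(\mu)$ if $$\phi(A)<3\phi(s)-2\phi(t)\quad\text{and}\quad2\phi(t)-\phi(s)<\phi(B).$$ Furthermore, for measures $\mu$ such that $\phi(A)=-\infty$, $(s,t)$ does not belong to $\Omega(\mu)$ if $2\phi(t)-\phi(s)>\phi(B)$.
   Context: Let $\mu$ be a $\sigma$-finite Borel measure on $\mathbb R$, $A=\inf\operatorname{supp}\mu$, $B=\sup\operatorname{supp}\mu$ (possibly infinite). Let $\Theta=\{\theta\in\mathbb R:\int e^{\theta x}\mu(dx)<\infty\}$, assumed nonempty and not a singleton, with interior $\Theta^\circ$; $\psi(\theta)=\log\int e^{\theta x}\mu(dx)$ (derivatives are considered on $\Theta^\circ$). Standing assumption: $\psi''>0$ on $\Theta^\circ$ and $\psi':\Theta^\circ\to(A,B)$ is a bijection with inverse $\phi$; write $\phi(A)=\inf\Theta$, $\phi(B)=\sup\Theta$ in $[-\infty,\infty]$. A positive function is log-convex if its logarithm is convex. An $m\times n$ margin is a pair $(\mathbf r,\mathbf c)\in\mathbb R^m\times\mathbb R^n$; $\mathcal T(\mathbf r,\mathbf c)$ is the set of real $m\times n$ matrices with row sums $\mathbf r$ and column sums $\mathbf c$. An MLE for $(\mathbf r,\mathbf c)$ is a maximizer of $\langle\mathbf r,\boldsymbol\alpha\rangle+\langle\mathbf c,\boldsymbol\beta\rangle-\sum_{i,j}\psi(\boldsymbol\alpha(i)+\boldsymbol\beta(j))$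 over $(\boldsymbol\alpha,\boldsymbol\beta)$ with all $\boldsymbol\alpha(i)+\boldsymbol\beta(j)\in\Theta^\circ$. For $\delta>0$, $A_\delta=\max(A+\delta,-1/\delta)$, $B_\delta=\min(B-\delta,1/\delta)$; $(\mathbf r,\mathbf c)$ is $\delta$-tame if an MLE exists and $A_\delta\le\psi'(\boldsymbol\alpha(i)+\boldsymbol\beta(j))\le B_\delta$ for all $i,j$. $\Omega(\mu)$ is the set of $(s,t)\in(A,B)^2$ with $s\le t$ for which there is $\delta=\delta(\mu,s,t)>0$ such that, for all $m,n\ge1$, every $m\times n$ margin $(\mathbf r,\mathbf c)$ satisfying $\mathcal T(\mathbf r,\mathbf c)\cap(A,B)^{m\times n}\ne\emptyset$ and $s\le\mathbf r(i)/n\le t$, $s\le\mathbf c(j)/m\le t$ for all $i,j$ is $\delta$-tame. *)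

(* Defs.v *)
From HB Require Import structures.
From mathcomp Require Import all_boot all_order all_algebra.
From mathcomp Require Import all_classical all_reals all_analysis.

Set Implicit Arguments.
Unset Strict Implicit.
Unset Printing Implicit Defensive.

Import Order.TTheory GRing.Theory Num.Theory.
Import numFieldNormedType.Exports.

Local Open Scope classical_set_scope.
Local Open Scope ring_scope.

Notation borel_measure R :=
  {sigma_finite_measure set (measurableTypeR R) -> \bar R}.

Definition msupp (R : realType) (mu : borel_measure R) : set R :=
  [set x | forall U : set R, open U -> U x -> (0 < mu U)%E].

Definition suppA (R : realType) (mu : borel_measure R) : \bar R :=
  ereal_inf (EFin @` msupp mu).

Definition suppB (R : realType) (mu : borel_measure R) : \bar R :=
  ereal_sup (EFin @` msupp mu).

Definition mean_domain (R : realType) (mu : borel_measure R) : set R :=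
  [set x | (suppA mu < x%:E)%E /\ (x%:E < suppB mu)%E].

Definition laplace (R : realType) (mu : borel_measure R) (theta : R) : \bar R :=
  (\int[mu]_x (expR (theta * x))%:E)%E.

Definition Theta (R : realType) (mu : borel_measure R) : set R :=
  [set theta | (laplace mu theta < +oo)%E].

(* Only meaningful on Theta mu: elsewhere [fine] sends +oo to 0. *)
Definition psi (R : realType) (mu : borel_measure R) (theta : R) : R :=
  ln (fine (laplace mu theta)).

(* Derivatives of psi are only used on the interior of Theta mu. *)
Definition psi' (R : realType) (mu : borel_measure R) : R -> R :=
  derive1 (psi mu).

Definition psi'' (R : realType) (mu : borel_measure R) : R -> R :=
  derive1n 2 (psi mu).

(* The inverse of psi' on the interior of Theta; values outside
   [mean_domain mu] are irrelevant. Its extension to the endpoints A and B is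
   given by [phiA] and [phiB]. *)
Definition phi (R : realType) (mu : borel_measure R) : R -> R :=
  'pinv_(fun=> 0) (Theta mu)^° (psi' mu).

Definition phiA (R : realType) (mu : borel_measure R) : \bar R :=
  ereal_inf (EFin @` Theta mu).

Definition phiB (R : realType) (mu : borel_measure R) : \bar R :=
  ereal_sup (EFin @` Theta mu).

Definition log_convex_on (R : realType) (D : set R) (f : R -> R) : Prop :=
  {in D, forall x, 0 < f x} /\
  convex_function (D : set (convex_lmodType R^o)) (fun x => ln (f x)).

Definition transport (R : realType) (m n : nat)
    (r : 'rV[R]_m) (c : 'rV[R]_n) : set 'M[R]_(m, n) :=
  [set X | (forall i, \sum_j X i j = r 0 i) /\
           (forall j, \sum_i X i j = c 0 j)].

Definition dual_admissible (R : realType) (mu : borel_measure R) (m n : nat)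
    (a : 'rV[R]_m) (b : 'rV[R]_n) : Prop :=
  forall i j, (Theta mu)^° (a 0 i + b 0 j).

Definition loglik (R : realType) (mu : borel_measure R) (m n : nat)
    (r : 'rV[R]_m) (c : 'rV[R]_n) (a : 'rV[R]_m) (b : 'rV[R]_n) : R :=
  \sum_i r 0 i * a 0 i + \sum_j c 0 j * b 0 j
  - \sum_i \sum_j psi mu (a 0 i + b 0 j).

Definition is_MLE (R : realType) (mu : borel_measure R) (m n : nat)
    (r : 'rV[R]_m) (c : 'rV[R]_n) (a : 'rV[R]_m) (b : 'rV[R]_n) : Prop :=
  dual_admissible mu a b /\
  forall a' b', dual_admissible mu a' b' ->
    loglik mu r c a' b' <= loglik mu r c a b.

Definition A_ (R : realType) (mu : borel_measure R) (delta : R) : \bar R :=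
  maxe (suppA mu + delta%:E)%E (- delta^-1)%:E.

Definition B_ (R : realType) (mu : borel_measure R) (delta : R) : \bar R :=
  mine (suppB mu - delta%:E)%E (delta^-1)%:E.

(* When psi is strictly convex, MLEs differ only by shifts (a + k, b - k),
   which leave a i + b j unchanged, so it does not matter which MLE the bounds
   are required for. *)
Definition tame (R : realType) (mu : borel_measure R) (delta : R) (m n : nat)
    (r : 'rV[R]_m) (c : 'rV[R]_n) : Prop :=
  exists a b, is_MLE mu r c a b /\
    forall i j, (A_ mu delta <= (psi' mu (a 0 i + b 0 j))%:E)%E /\
                ((psi' mu (a 0 i + b 0 j))%:E <= B_ mu delta)%E.

Definition Omega (R : realType) (mu : borel_measure R) : set (R * R) :=
  [set st | [/\ mean_domain mu st.1, mean_domain mu st.2, st.1 <= st.2 &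
    exists2 delta : R, 0 < delta &
      forall (m n : nat) (r : 'rV[R]_m) (c : 'rV[R]_n),
        (0 < m)%N -> (0 < n)%N ->
        (exists X, transport r c X /\ forall i j, mean_domain mu (X i j)) ->
        (forall i, st.1 <= r 0 i / n%:R /\ r 0 i / n%:R <= st.2) ->
        (forall j, st.1 <= c 0 j / m%:R /\ c 0 j / m%:R <= st.2) ->
        tame mu delta r c]].

(* Main.v *)
Require Import Defs.
From HB Require Import structures.
From mathcomp Require Import all_boot all_order all_algebra.
From mathcomp Require Import all_classical all_reals all_analysis.
From mathcomp Require Import measurable_realfun ring lra.

(**
The margins of the table of means psi'(a i + b j) are r and c exactly when
(a, b) is an MLE, and the sums a i + b j are then unique. Since psi'' is
log-convex, psi'(x + h) is a convex function of psi'(x) for each h >= 0;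
Jensen's inequality along the rows shows that the a i, and likewise the b j,
spread over at most phi(t) - phi(s), and a second application along a column
gives a i + b j <= 2 phi(t) - phi(s). Together these bounds confine all the
a i + b j to [2 phi(s) - phi(t), 2 phi(t) - phi(s)], hence the tameness.

An MLE exists as soon as some table with margins (r, c) has its entries in
(A, B): at a maximizer over a large box, comparison with a constant table
prevents the boundary from being reached, because (psi'(x) - w) (x - x0) is
unbounded at both ends of the interior of Theta (if A is finite then
phi(A) = -oo, and B is infinite).

Conversely, if 2 phi(t) - phi(s) > phi(B), a square table whose first row and
first column have dual parameter x < phi(t), whose corner has 2 x - phi(s)
close to phi(B), and whose remaining entries have phi(s), has averages in
[s, t] when it is large enough, while its corner mean is as large as desired.
*)

Set Implicit Arguments.
Unset Strict Implicit.
Unset Printing Implicit Defensive.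

Import Order.TTheory GRing.Theory Num.Theory.
Import numFieldNormedType.Exports.

Local Open Scope classical_set_scope.
Local Open Scope ring_scope.

(* [derive1 f x] is a limit, and a divergent limit is [0] by convention. *)
Lemma derivable_of_derive1_neq0 (R : realType) (f : R -> R) (x : R) :
  derive1 f x != 0 -> derivable f x 1.
Proof.
apply: contra_neqP => ndf; rewrite derive1E.
by rewrite /derive dvgP.
Qed.

(** * The Laplace transform and its domain *)

Section laplace.
Variables (R : realType) (mu : borel_measure R).
Implicit Types (a b x y theta : R).

Lemma measurable_expR_scale theta : measurable_fun [set: measurableTypeR R]
  (fun x : measurableTypeR R => (expR (theta * x))%:E).
Proof.
have h := measurableT_comp (@measurable_expR R)
  (@mulrl_measurable R setT theta).
exact: (measurableT_comp (@EFin_measurable R setT) h).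
Qed.

Lemma Theta_integrable theta : Theta mu theta ->
  mu.-integrable [set: measurableTypeR R] (fun x => (expR (theta * x))%:E).
Proof.
move=> Tt; apply/integrableP; split; first exact: measurable_expR_scale.
rewrite (_ : (\int[mu]_x _)%E = laplace mu theta)//.
by apply: eq_integral => x _; rewrite gee0_abs// lee_fin expR_ge0.
Qed.

Lemma Theta_dominated theta (g : measurableTypeR R -> R) :
  mu.-integrable [set: measurableTypeR R] (EFin \o g) ->
  {ae mu, forall x, expR (theta * x) <= g x} -> Theta mu theta.
Proof.
move=> ig le_g; rewrite /Theta /= /laplace.
have [mg ig'] := integrableP _ _ _ ig.
apply: le_lt_trans ig'; apply: ae_ge0_le_integral => //.
- exact: measurable_expR_scale.
- by apply: (measurableT_comp (@abse_measurable R setT)).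
- apply: (@filterS _ _ (ae_filter_ringOfSetsType mu)) le_g => x h _ /=;
    rewrite lee_fin.
  exact: le_trans h (ler_norm _).
Qed.

(** Depending on the sign of [y], the exponential at [x] is below the one at [b] or the one at [a],
    so their sum dominates it. *)
Lemma Theta_itv a b x : Theta mu a -> Theta mu b -> a <= x <= b -> Theta mu x.
Proof.
move=> Ta Tb /andP[ax xb].
apply: (@Theta_dominated _ (fun y => expR (a * y) + expR (b * y))).
  rewrite [X in integrable _ _ X](_ : _ = fun y : measurableTypeR R =>
     ((expR (a * y))%:E + (expR (b * y))%:E)%E)//.
  by apply: integrableD => //; exact: Theta_integrable.
apply/aeW => y; have [y0|/ltW y0] := leP 0 y.
- by rewrite (le_trans (y := expR (b * y)))// ?lerDr ?expR_ge0// ler_expR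
    ler_wpM2r.
- by rewrite (le_trans (y := expR (a * y)))// ?lerDl ?expR_ge0// ler_expR
    ler_wnM2r.
Qed.

Lemma Theta_interior a b x :
  Theta mu a -> Theta mu b -> a < x < b -> (Theta mu)^° x.
Proof.
move=> Ta Tb axb; rewrite /interior.
apply: (@filterS _ _ _ `]a, b[%classic).
  move=> y /=; rewrite in_itv/= => /andP[ay yb].
  by apply: Theta_itv Ta Tb _; rewrite !ltW.
by apply: near_in_itvoo; rewrite in_itv.
Qed.

Lemma interior_Theta x : (Theta mu)^° x ->
  exists2 e : R, 0 < e & Theta mu (x - e) /\ Theta mu (x + e).
Proof.
move=> /nbhs_ballP[e/= e0 xe]; exists (e / 2); first by rewrite divr_gt0.
split; apply: xe; rewrite /ball/=.
- by rewrite opprB addrC subrK gtr0_norm ?divr_gt0// ltr_pdivrMr// ltr_pMr//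
    ltr1n.
- rewrite opprD addrA subrr add0r normrN gtr0_norm ?divr_gt0//.
  by rewrite ltr_pdivrMr// ltr_pMr// ltr1n.
Qed.

Lemma interior_Theta_itv a b x :
  (Theta mu)^° a -> (Theta mu)^° b -> a <= x <= b -> (Theta mu)^° x.
Proof.
move=> /interior_Theta[e e0 [Ta _]] /interior_Theta[e' e'0 [_ Tb]] /andP[ax xb].
by apply: (Theta_interior Ta Tb); lra.
Qed.

Lemma interior_Theta_phi x :
  (phiA mu < x%:E)%E -> (x%:E < phiB mu)%E -> (Theta mu)^° x.
Proof.
move=> /ereal_inf_lt[_ [a Ta <-]]; rewrite lte_fin => ax.
move=> /ereal_sup_gt[_ [b Tb <-]]; rewrite lte_fin => xb.
by apply: (Theta_interior Ta Tb); rewrite ax.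
Qed.

Lemma phi_interior_Theta x : (Theta mu)^° x ->
  (phiA mu < x%:E)%E /\ (x%:E < phiB mu)%E.
Proof.
move=> /interior_Theta[e e0 [Ta Tb]]; split.
- apply: (@le_lt_trans _ _ (x - e)%:E); last by rewrite lte_fin; lra.
  by apply: ereal_inf_lbound; exists (x - e).
- apply: (@lt_le_trans _ _ (x + e)%:E); first by rewrite lte_fin; lra.
  by apply: ereal_sup_ubound; exists (x + e).
Qed.

(** Differentiation under the integral sign on the interval of radius [e / 2] around [x]; the room
    left up to [x - e] and [x + e] absorbs the factor [y] produced by the derivative. *)
Lemma derivable_laplace x : (Theta mu)^° x ->
  derivable (fine \o laplace mu) x 1.
Proof.
move=> /interior_Theta[e e0 [Ta Tb]].
pose G (y : measurableTypeR R) := (2 / e) * (expR ((x - e) * y) + expR ((x + e)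
  * y)).
have e20 : 0 < e / 2 by rewrite divr_gt0.
have itvT z : `]x - e / 2, x + e / 2[%classic z -> Theta mu z.
  by rewrite /= in_itv/= => /andP[? ?]; apply: (Theta_itv Ta Tb); lra.
apply: (@derivable_under_integral _ _ _ mu (fun t (y : measurableTypeR R) =>
  expR (t * y))
  setT measurableT x (x - e / 2) (x + e / 2) _ _ _ G) => //.
- by rewrite /= in_itv/=; lra.
- by move=> z /itvT /Theta_integrable.
- by move=> y; rewrite mulr_ge0 ?addr_ge0 ?expR_ge0// divr_ge0// ltW.
- rewrite [X in integrable _ _ X](_ : _ = fun y : measurableTypeR R =>
     ((2 / e)%:E * ((expR ((x - e) * y))%:E + (expR ((x + e) * y))%:E))%E)//.
  by apply: integrableZl => //; apply: integrableD => //;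
    exact: Theta_integrable.
- move=> z y; rewrite /= in_itv/= => /andP[z1 z2] _.
  have dz : is_derive z 1 (fun t => expR (t * y)) (y * expR (z * y)).
    rewrite mulrC; apply: (is_derive1_comp (f := expR)).
    rewrite (_ : (fun t => t * y) = y \*: id); last by apply/funext => t /=;
      rewrite mulrC.
    by apply: is_derive_eq; rewrite scaler1.
  rewrite /partial1of2 derive1E (@derive_val _ _ _ _ _ _ _ dz) normrM
    (ger0_norm (expR_ge0 _)).
  have h1 : `|y| <= 2 / e * expR (e / 2 * `|y|).
    rewrite -(@ler_pM2l _ (e / 2))// mulrA.
    rewrite (_ : e / 2 * (2 / e) = 1) ?mul1r; last by field; rewrite gt_eqF.
    by rewrite (le_trans _ (expR_ge1Dx _))// lerDr.
  have h2 : expR (z * y + e / 2 * `|y|) <=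
      expR ((x - e) * y) + expR ((x + e) * y).
    have [y0|/ltW y0] := leP 0 y.
    + rewrite (le_trans (y := expR ((x + e) * y)))// ?lerDr ?expR_ge0//
        ler_expR (ger0_norm y0).
      by rewrite -mulrDl ler_wpM2r//; lra.
    + rewrite (le_trans (y := expR ((x - e) * y)))// ?lerDl ?expR_ge0//
        ler_expR (ler0_norm y0).
      by rewrite mulrN -mulNr -mulrDl ler_wnM2r//; lra.
  apply: (@le_trans _ _ (2 / e * expR (e / 2 * `|y|) * expR (z * y))).
    by rewrite ler_wpM2r// expR_ge0.
  by rewrite -mulrA -expRD addrC /G ler_wpM2l// divr_ge0// ltW.
Qed.
End laplace.

(** * The support of the measure and positivity of its transform *)

Section support.
Variables (R : realType) (mu : borel_measure R).
Implicit Types (a b c x y theta : R).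

Let itv_if_null (q : rat * rat) : set (measurableTypeR R) :=
  [set x | mu (`]ratr q.1, ratr q.2[%classic : set R) = 0%E /\
     ratr q.1 < x < ratr q.2].

(** A point off the support has a null neighbourhood, hence lies in a null interval with rational
    endpoints, and there are only countably many of these. *)
Lemma negligible_msuppC : mu.-negligible (~` msupp mu).
Proof.
pose F (n : nat) := oapp itv_if_null set0 (unpickle n).
have FE q : F (pickle q) = itv_if_null q by rewrite /F pickleK.
apply: (@negligibleS _ _ _ mu (\bigcup_n F n)).
  move=> x /existsNP[U] /not_implyP[oU] /not_implyP[Ux] /negP.
  rewrite -leNgt => mU.
  have /nbhs_ballP[e/= e0 xeU] : nbhs x U by exact: open_nbhs_nbhs.
  have /rat_in_itvoo[q1] : x - e < x by lra.
  rewrite in_itv/= => /andP[q1l q1r].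
  have /rat_in_itvoo[q2] : x < x + e by lra.
  rewrite in_itv/= => /andP[q2l q2r].
  exists (pickle (q1, q2)); first exact: I.
  rewrite FE; split; last by rewrite q1r.
  apply/eqP; rewrite -measure_le0; apply: le_trans mU.
  apply: le_measure; rewrite ?inE.
  - exact: measurable_itv.
  - exact: open_measurable.
  - move=> y /=; rewrite in_itv/= => /andP[? ?]; apply: xeU.
    by rewrite /ball/= ltr_norml; lra.
apply: negligible_bigcup => n; rewrite /F.
case: unpickle => [q|]/=; last exact: negligible_set0.
have [q0|q0] := pselect (mu (`]ratr q.1, ratr q.2[%classic : set R) = 0%E).
- exists `]ratr q.1, ratr q.2[%classic; split=> //.
  by move=> x [_]; rewrite /= in_itv.
- by apply: negligibleS (negligible_set0 mu) => x [/q0].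

Qed.

(* The hypothesis says that, on the support, [expR (theta * x)] is at most a
   constant multiple of [expR (theta0 * x)]. *)
Lemma Theta_msupp theta0 theta c : Theta mu theta0 ->
  (forall x, msupp mu x -> (theta - theta0) * (x - c) <= 0) -> Theta mu theta.
Proof.
(* On the support, the ratio of the two exponentials is at most its value [k] at [c]. *)
move=> T0 H; pose k := expR ((theta - theta0) * c).
apply: (@Theta_dominated _ _ _ (fun x : measurableTypeR R => k * expR (theta0 *
  x))).
  rewrite [X in integrable _ _ X](_ : _ = fun y : measurableTypeR R =>
     (k%:E * (expR (theta0 * y))%:E)%E)//.
  by apply: integrableZl => //; exact: Theta_integrable.
apply: negligibleS negligible_msuppC => x; apply: contra_not => /H {}H.
rewrite /= /k -expRD ler_expR; nra.
Qed.

Lemma interior_Theta_up b theta0 theta : (suppB mu <= b%:E)%E ->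
  (Theta mu)^° theta0 -> theta0 <= theta -> (Theta mu)^° theta.
Proof.
move=> sB /interior_Theta[e e0 [T0 _]] le_t.
have T1 : Theta mu (theta + 1).
  apply: (Theta_msupp (c := b) T0) => x sx.
  apply: mulr_ge0_le0; first by lra.
  rewrite subr_le0 -lee_fin (le_trans _ sB)//.
  by apply: ereal_sup_ubound; exact: imageP.
by apply: (Theta_interior T0 T1); lra.
Qed.

Lemma interior_Theta_down a theta0 theta : (a%:E <= suppA mu)%E ->
  (Theta mu)^° theta0 -> theta <= theta0 -> (Theta mu)^° theta.
Proof.
move=> sA /interior_Theta[e e0 [_ T0]] le_t.
have T1 : Theta mu (theta - 1).
  apply: (Theta_msupp (c := a) T0) => x sx.
  apply: mulr_le0_ge0; first by lra.
  rewrite subr_ge0 -lee_fin (le_trans sA)//.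
  by apply: ereal_inf_lbound; exact: imageP.
by apply: (Theta_interior T1 T0); lra.
Qed.

(** The integrand never vanishes, so a zero integral would make the whole line null, which a
    nonempty support forbids. *)
Lemma laplace_gt0 theta : msupp mu !=set0 -> (0 < laplace mu theta)%E.
Proof.
move=> [x0 sx0]; have muT : (0 < mu setT)%E by apply: sx0 => //; exact: openT.
rewrite lt_neqAle integral_ge0 ?andbT//; apply/negP => /eqP/esym L0.
have [H _] := @ae_eq_integral_abs _ _ _ mu setT measurableT _
  (measurable_expR_scale theta).
have /H : (\int[mu]_x `|(expR (theta * x))%:E| = 0)%E.
  by rewrite -[RHS]L0; apply: eq_integral => x _;
    rewrite gee0_abs// lee_fin expR_ge0.
move=> nT; move: muT; rewrite (_ : mu setT = 0%E) ?ltxx//.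
apply/negligibleP => //; apply: negligibleS nT => x _ /=.
by move=> /(_ I) [] /eqP; rewrite gt_eqF ?expR_gt0.
Qed.

Lemma derivable_psi x : msupp mu !=set0 -> (Theta mu)^° x ->
  derivable (psi mu) x 1.
Proof.
move=> s0 Tx; have dL := derivable_laplace Tx.
have L0 : 0 < (fine \o laplace mu) x.
  by rewrite /= fine_gt0// laplace_gt0//=; have := interior_subset Tx.
have h := is_derive1_comp (is_derive1_ln L0) (derivableP dL).
by have [] := h.
Qed.

End support.

(** * Tables of means of a function with log-convex derivative *)

Lemma sumr_le_const_ex (R : realDomainType) (n : nat) (f : 'I_n -> R) (c : R) :
  (0 < n)%N -> \sum_j f j <= n%:R * c -> exists j, f j <= c.
Proof.
case: n f => // n f _; apply: contraPP => /forallNP H; apply/negP;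
  rewrite -ltNge.
rewrite mulr_natl -[X in c *+ X]card_ord -sumr_const; apply: ltr_sum.
  by apply/hasP; exists ord0; rewrite ?mem_index_enum.
by move=> j _; rewrite ltNge; apply/negP/H.
Qed.

Lemma sumr_ge_const_ex (R : realDomainType) (n : nat) (f : 'I_n -> R) (c : R) :
  (0 < n)%N -> n%:R * c <= \sum_j f j -> exists j, c <= f j.
Proof.
move=> n0 H; have [|j] := @sumr_le_const_ex R n (fun j => - f j) (- c) n0.
  by rewrite sumrN mulrN lerN2.
by rewrite lerN2; exists j.
Qed.

Lemma sumr_subr_const (R : pzRingType) (n : nat) (f : 'I_n -> R) (c : R) :
  \sum_j (f j - c) = \sum_j f j - n%:R * c.
Proof. by rewrite sumrB sumr_const card_ord mulr_natl. Qed.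

Lemma MVT_itv (R : realType) (J : set R) (f df : R -> R) (a b : R) :
  (forall x y z, J x -> J y -> x <= z <= y -> J z) ->
  (forall x, J x -> is_derive x 1 f (df x)) -> J a -> J b -> a <= b ->
  exists c, [/\ a <= c, c <= b & f b - f a = df c * (b - a)].
Proof.
move=> J_itv dJ Ja Jb ab.
have dab x : x \in `]a, b[ -> is_derive x 1 f (df x).
  by rewrite in_itv/= => /andP[ax xb]; apply: dJ; apply: (J_itv a b);
    rewrite // !ltW.
have cab : {within `[a, b], continuous f}.
  apply: derivable_within_continuous => x; rewrite in_itv/= => xab.
  by have [] := dJ _ (J_itv _ _ _ Ja Jb xab).
by have [c] := MVT_segment ab dab cab; rewrite in_itv/= => /andP[ac cb] e;
  exists c.
Qed.

(** * Shift inequalities; [p], [p1], [p2] stand for psi and its first two derivatives on an interval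
    [I] *)

Section cumulant.
Variables (R : realType) (I : set R) (p p1 p2 : R -> R).
Hypothesis I_itv : forall a b x, I a -> I b -> a <= x <= b -> I x.
Hypothesis dp : forall x, I x -> is_derive x 1 p (p1 x).
Hypothesis dp1 : forall x, I x -> is_derive x 1 p1 (p2 x).
Hypothesis p2_gt0 : forall x, I x -> 0 < p2 x.
Hypothesis p2_logconvex : forall (x y t : R), I x -> I y -> 0 <= t <= 1 ->
  ln (p2 (t * x + (1 - t) * y)) <= t * ln (p2 x) + (1 - t) * ln (p2 y).
Implicit Types (a b x y z h : R).

Lemma ltr_p1 x y : I x -> I y -> x < y -> p1 x < p1 y.
Proof.
move=> Ix Iy xy; rewrite -subr_gt0.
have [c [xc cy ->]] := MVT_itv I_itv dp1 Ix Iy (ltW xy).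
by rewrite mulr_gt0 ?subr_gt0// p2_gt0//; apply: (I_itv Ix Iy); rewrite xc.
Qed.

Lemma ler_p1 x y : I x -> I y -> (p1 x <= p1 y) = (x <= y).
Proof.
move=> Ix Iy; have [xy|yx|->] := ltgtP x y; last by rewrite lexx.
- by rewrite ltW// ltr_p1.
- by apply/negbTE; rewrite -ltNge ltr_p1.
Qed.

Lemma p_ge_tangent x y : I x -> I y -> p1 x * (y - x) <= p y - p x.
Proof.
move=> Ix Iy; have [xy|/ltW yx] := leP x y.
- have [c [xc cy ->]] := MVT_itv I_itv dp Ix Iy xy.
  have Ic : I c by apply: (I_itv Ix Iy); rewrite xc.
  by rewrite ler_wpM2r ?subr_ge0// ler_p1.
- have [c [yc cx H]] := MVT_itv I_itv dp Iy Ix yx.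
  have Ic : I c by apply: (I_itv Iy Ix); rewrite yc.
  rewrite -lerN2 opprB H -mulrN opprB ler_wpM2r ?subr_ge0// ler_p1//.
Qed.

(** The points [x] and [y + h] are convex combinations of [y] and [x + h] with complementary
    weights; the two log-convexity inequalities add up to the claim. *)
Lemma p2_shift_ratio x y h : I y -> I (x + h) -> 0 <= h -> y <= x ->
  p2 x * p2 (y + h) <= p2 y * p2 (x + h).
Proof.
move=> Iy Ixh h0 yx.
have [e|neq] := eqVneq y (x + h).
  have h_eq0 : h = 0 by lra.
  by rewrite e h_eq0 !addr0.
have yxh : y < x + h by rewrite lt_neqAle neq/=; lra.
have Ix : I x by apply: (I_itv Iy Ixh); lra.
have Iyh : I (y + h) by apply: (I_itv Iy Ixh); lra.
pose t := h / (x + h - y).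
have d0 : 0 < x + h - y by lra.
have t01 : 0 <= t <= 1.
  by rewrite /t divr_ge0 ?(ltW d0)//= ler_pdivrMr// mul1r; lra.
have := p2_logconvex Iy Ixh t01.
rewrite (_ : t * y + _ = x); last by rewrite /t; field; lra.
have t01' : 0 <= 1 - t <= 1 by lra.
have := p2_logconvex Iy Ixh t01'.
rewrite (_ : (1 - t) * y + _ = y + h); last by rewrite /t; field; lra.
move=> H1 H2.
rewrite -ler_ln ?posrE ?mulr_gt0 ?p2_gt0//.
by rewrite !lnM ?posrE ?p2_gt0//; lra.
Qed.

(* The map taking [p1 x] to [p1 (x + h)] is convex, since its derivative
   [p2 (x + h) / p2 x] is nondecreasing in [x]; this is its tangent line
   inequality at [p1 y]. *)
Lemma p1_shift_tangent x y h : I x -> I (x + h) -> I y -> I (y + h) -> 0 <= h ->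
  p2 (y + h) * (p1 x - p1 y) <= p2 y * (p1 (x + h) - p1 (y + h)).
Proof.
move=> Ix Ixh Iy Iyh h0.
(* The derivative of [D] vanishes at [y] and, by [p2_shift_ratio], is nonpositive before [y] and
   nonnegative after it, so [D] is least at [y]. *)
pose D z := p2 y * p1 (z + h) - p2 (y + h) * p1 z.
pose J z := I z /\ I (z + h).
have J_itv a b z : J a -> J b -> a <= z <= b -> J z.
  move=> [Ia Iah] [Ib Ibh] azb; split; first exact: I_itv azb.
  by apply: (I_itv Iah Ibh); rewrite !lerD2r.
pose dD z := p2 y * p2 (z + h) - p2 (y + h) * p2 z.
have dDP z : J z -> is_derive z 1 D (dD z).
  move=> [Iz Izh]; have d1 := dp1 Iz; have d2 := dp1 Izh.
  have d3 : is_derive z 1 (fun z => p1 (z + h)) (p2 (z + h)).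
    rewrite -[p2 (z + h)]mulr1.
    apply: (is_derive1_comp (f := p1) (g := fun z => z + h)).
    by apply: is_derive_eq; rewrite addr0.
  rewrite /D; apply: is_derive_eq.
  by [].
have DE : p2 y * (p1 (x + h) - p1 (y + h)) - p2 (y + h) * (p1 x - p1 y) =
  D x - D y.
  by rewrite /D; ring.
rewrite -subr_ge0 DE.
have [yx|/ltW xy] := leP y x.
- have [c [yc cx ->]] := MVT_itv J_itv dDP (conj Iy Iyh) (conj Ix Ixh) yx.
  by rewrite mulr_ge0 ?subr_ge0// [p2 (y + h) * _]mulrC p2_shift_ratio//;
    apply: (I_itv Iyh Ixh); lra.
- have [c [xc cy H]] := MVT_itv J_itv dDP (conj Ix Ixh) (conj Iy Iyh) xy.
  rewrite -opprB H oppr_ge0 mulr_le0_ge0 ?subr_ge0// subr_le0.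
  by rewrite [p2 (y + h) * _]mulrC p2_shift_ratio//; apply: (I_itv Ix Iy); lra.
Qed.

(* Jensen's inequality for the concave map taking [p1 (x + h)] to [p1 x]. *)
Lemma p1_mean_shift n (x : 'I_n -> R) h z : (0 < n)%N -> 0 <= h ->
  (forall j, I (x j)) -> (forall j, I (x j + h)) -> I z ->
  \sum_j p1 (x j + h) <= n%:R * p1 z ->
  I (z - h) /\ \sum_j p1 (x j) <= n%:R * p1 (z - h).
Proof.
move=> n0 h0 Ix Ixh Iz le_z.
have Izh : I (z - h).
  (* Some [x j + h] is at most [z], so [z - h] lies between [x j] and [z]. *)
  have [j] := sumr_le_const_ex n0 le_z; rewrite ler_p1// => jz.
  by apply: (I_itv (Ix j) Iz); lra.
split=> //; have Izhh : I (z - h + h) by rewrite subrK.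
rewrite -subr_le0.
rewrite -(pmulr_rle0 _ (p2_gt0 Iz)) -sumr_subr_const.
apply: (@le_trans _ _ (p2 (z - h) * \sum_j (p1 (x j + h) - p1 z))); last first.
  by rewrite sumr_subr_const mulr_ge0_le0 ?subr_le0// ltW ?p2_gt0.
rewrite !mulr_sumr; apply: ler_sum => j _.
by have := p1_shift_tangent (Ix j) (Ixh j) Izh Izhh h0; rewrite subrK.
Qed.

(** * Spread of the dual parameters of a table with controlled margins *)

Section margins.
Variables (m n : nat) (a : 'I_m -> R) (b : 'I_n -> R) (xs xt : R).
Hypotheses (m_gt0 : (0 < m)%N) (n_gt0 : (0 < n)%N).
Hypotheses (Ixs : I xs) (Ixt : I xt) (xs_xt : xs <= xt).
Hypothesis Iab : forall i j, I (a i + b j).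
Hypothesis row_ge : forall i, n%:R * p1 xs <= \sum_j p1 (a i + b j).
Hypothesis row_le : forall i, \sum_j p1 (a i + b j) <= n%:R * p1 xt.

(** Row [k] is row [i] shifted by [a k - a i], so Jensen's inequality carries the upper bound on row
    [k] over to row [i], lowered by that shift. *)
Lemma row_shift k i : a i <= a k -> I (xt - a k + a i) /\
  \sum_j p1 (a i + b j) <= n%:R * p1 (xt - a k + a i).
Proof.
move=> ik; rewrite -addrA (_ : xt + _ = xt - (a k - a i)); last by ring.
have E j : a i + b j + (a k - a i) = a k + b j by ring.
apply: p1_mean_shift => //; first by rewrite subr_ge0.
  by move=> j; rewrite E.
by under eq_bigr do rewrite E.
Qed.

Lemma row_spread k i : a k - a i <= xt - xs.
Proof.
have [ik|/ltW ki] := leP (a i) (a k); last by move: xs_xt; lra.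
have [Ixt' le_xt'] := row_shift ik.
have := le_trans (row_ge i) le_xt'.
by rewrite ler_pM2l ?ltr0n// ler_p1//; lra.
Qed.

(** Take [k'] with [a k'] greatest. By [row_shift] and the lower bounds on the rows, every
    [p1 (a i + (xt - a k'))] is at least [p1 xs]. Column [l] is this column shifted by [h]; if
    [h >= 0], Jensen's inequality yields [xs <= xt - h]. *)
Lemma entry_le k l : \sum_i p1 (a i + b l) <= m%:R * p1 xt ->
  a k + b l <= 2 * xt - xs.
Proof.
move=> col_le.
have [k' _ k'_max] := arg_maxP a (erefl : xpredT k).
suff : a k' + b l <= 2 * xt - xs by have /= := k'_max k isT; lra.
have Ia' i : I (a i + (xt - a k')).
  by have [] := row_shift (k'_max i isT); rewrite addrC.
have [lt_b|le_b] := ltP (b l) (xt - a k').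
  by move: lt_b xs_xt; lra.
pose h := b l - (xt - a k').
have E i : a i + (xt - a k') + h = a i + b l by rewrite /h; ring.
have Eh : \sum_i p1 (a i + (xt - a k') + h) <= m%:R * p1 xt.
  by under eq_bigr do rewrite E.
have Iabh i : I (a i + (xt - a k') + h) by rewrite E.
have h0 : 0 <= h by rewrite subr_ge0.
have [Ixth le_xth] := p1_mean_shift m_gt0 h0 Ia' Iabh Ixt Eh.
have : m%:R * p1 xs <= \sum_i p1 (a i + (xt - a k')).
  rewrite -(@ler_pM2l _ n%:R) ?ltr0n// mulr_sumr mulrCA mulr_natl.
  rewrite -[X in _ *+ X]card_ord -sumr_const; apply: ler_sum => i _.
  by apply: le_trans (row_ge i) _; have [_] := row_shift (k'_max i isT);
    rewrite [_ + a i]addrC.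
move=> /le_trans /(_ le_xth).
by rewrite ler_pM2l ?ltr0n// ler_p1// /h; lra.
Qed.
End margins.

(** The upper bound is [entry_le]. For the lower one, row [i] has a parameter at least [xs], and
    [row_spread] for the transposed table limits the drop from there to column [j]. *)
Lemma entry_bounds m n (a : 'I_m -> R) (b : 'I_n -> R) (xs xt : R) :
  (0 < m)%N -> (0 < n)%N -> I xs -> I xt -> xs <= xt ->
  (forall i j, I (a i + b j)) ->
  (forall i, n%:R * p1 xs <= \sum_j p1 (a i + b j) <= n%:R * p1 xt) ->
  (forall j, m%:R * p1 xs <= \sum_i p1 (a i + b j) <= m%:R * p1 xt) ->
  forall i j, 2 * xs - xt <= a i + b j <= 2 * xt - xs.
Proof.
move=> m0 n0 Ixs Ixt xst Iab row col i j.
have row_ge i' : n%:R * p1 xs <= \sum_j' p1 (a i' + b j') by have /andP[] :=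
  row i'.
have row_le i' : \sum_j' p1 (a i' + b j') <= n%:R * p1 xt by have /andP[] :=
  row i'.
have /andP[_ col_le] := col j.
rewrite (entry_le m0 n0 Ixs Ixt xst Iab row_ge row_le i col_le) andbT.
have [l] := sumr_ge_const_ex n0 (row_ge i); rewrite ler_p1// => xsl.
have spread : b l - b j <= xt - xs.
  apply: (@row_spread n m b a) => //.
  - by move=> ? ?; rewrite addrC.
  - by move=> l'; under eq_bigr do rewrite addrC; have /andP[] := col l'.
  - by move=> l'; under eq_bigr do rewrite addrC; have /andP[] := col l'.
lra.
Qed.
End cumulant.

(** * The likelihood equations *)

(** A one-sided comparison suffices, so this applies also to a maximizer on the boundary of a box,
    moved inwards. *)
Lemma is_derive_le0 (R : realType) (f : R -> R) (x d e : R) :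
  is_derive x 1 f d -> 0 < e -> (forall h, 0 < h < e -> f (x + h) <= f x) ->
  d <= 0.
Proof.
move=> [df <-] e0 fle; rewrite -derive1E /derive1.
have cf : cvg ((fun h : R => h^-1 *: (f (h + x) - f x)) @ 0^').
  by move: df; rewrite /derivable; under eq_fun do rewrite scaler1.
rewrite cvg_at_rightE//; apply: limr_le.
  move/cvg_ex : cf => [l cf]; apply/cvg_ex; exists l.
  apply: cvg_trans cf; apply: cvg_app => A [e1 e10 Ae1];
    exists e1 => // y ye y0.
  by apply: Ae1 => //; exact/lt0r_neq0.
near=> h; have h0 : 0 < h by near: h; exact: nbhs_right_gt.
rewrite /= pmulr_rle0 ?invr_gt0// subr_le0 addrC fle// h0/=.
by near: h; exact: nbhs_right_lt.
Unshelve. all: by end_near. Qed.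

Section likelihood.
Variables (R : realType) (mu : borel_measure R) (m n : nat).
Hypothesis d_psi : forall x,
  (Theta mu)^° x -> is_derive x 1 (psi mu) (psi' mu x).
Implicit Types (r a u : 'rV[R]_m) (c b v : 'rV[R]_n).

(** The pairing of a table with the sums [a i + b j] sees only its margins, so any table in
    [transport r c] can replace [r] and [c] in the likelihood. *)
Lemma transport_pairing r c (X : 'M[R]_(m, n)) a b : transport r c X ->
  \sum_i \sum_j X i j * (a 0 i + b 0 j) =
  \sum_i r 0 i * a 0 i + \sum_j c 0 j * b 0 j.
Proof.
move=> [Xr Xc].
under eq_bigr do (under eq_bigr do rewrite mulrDr;
  rewrite big_split/= -mulr_suml Xr).
rewrite big_split/= exchange_big/=; congr (_ + _).
by apply: eq_bigr => j _; rewrite -mulr_suml Xc.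
Qed.

Lemma loglik_transport r c (X : 'M[R]_(m, n)) a b : transport r c X ->
  loglik mu r c a b =
  \sum_i \sum_j (X i j * (a 0 i + b 0 j) - psi mu (a 0 i + b 0 j)).
Proof.
move=> rcX; under [RHS]eq_bigr do rewrite sumrB.
by rewrite sumrB (transport_pairing _ _ rcX).
Qed.

Definition mean_mx a b : 'M[R]_(m, n) := \matrix_(i, j) psi' mu (a 0 i + b 0 j).

Lemma mean_mxE a b i j : mean_mx a b i j = psi' mu (a 0 i + b 0 j).
Proof. by rewrite mxE. Qed.

(** The derivative of the likelihood at [(a, b)] in the direction [(u, v)]. *)
Definition dloglik r c a b u v : R :=
  \sum_i r 0 i * u 0 i + \sum_j c 0 j * v 0 j
  - \sum_i \sum_j psi' mu (a 0 i + b 0 j) * (u 0 i + v 0 j).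

Lemma dloglikN r c a b u v :
  dloglik r c a b (- u) (- v) = - dloglik r c a b u v.
Proof.
rewrite /dloglik opprD [- (\sum_i r 0 i * _ + _)]opprD -!sumrN.
congr (_ + _ + _); apply: eq_bigr => i _; rewrite ?mxE ?mulrN// -!sumrN.
by apply: eq_bigr => j _; rewrite !mxE; ring.
Qed.

Lemma is_derive_loglik r c a b u v : dual_admissible mu a b ->
  is_derive (0 : R) 1 (fun h : R => loglik mu r c (a + h *: u) (b + h *: v))
    (dloglik r c a b u v).
Proof.
move=> ab.
have dterm i j : is_derive (0 : R) 1
    (fun h : R => psi mu ((a + h *: u) 0 i + (b + h *: v) 0 j))
    (psi' mu (a 0 i + b 0 j) * (u 0 i + v 0 j)).
  apply: (is_derive1_comp (f := psi mu)
    (g := fun h : R => (a + h *: u) 0 i + (b + h *: v) 0 j)).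
    by rewrite !scale0r !addr0; exact: d_psi.
  rewrite (_ : (fun h : R => _) =
    (fun h : R => (a 0 i + b 0 j) + (u 0 i + v 0 j) * h)).
    by apply: is_derive_eq; rewrite add0r mul1r [_%:A]mulr1.
  by apply/funext => h; rewrite !mxE; ring.
have dsum : is_derive (0 : R) 1
    (\sum_i \sum_j (fun h : R => psi mu ((a + h *: u) 0 i + (b + h *: v) 0 j)))
    (\sum_i \sum_j psi' mu (a 0 i + b 0 j) * (u 0 i + v 0 j)).
  by apply: is_derive_sum => i; apply: is_derive_sum => j.
pose k0 := \sum_i r 0 i * a 0 i + \sum_j c 0 j * b 0 j.
pose k1 := \sum_i r 0 i * u 0 i + \sum_j c 0 j * v 0 j.
rewrite (_ : (fun h : R => _) = (fun h => k0 + k1 * h) -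
   \sum_i \sum_j (fun h : R => psi mu ((a + h *: u) 0 i + (b + h *: v) 0 j))).
  have dk : is_derive (0 : R) 1 (fun h : R => k0 + k1 * h) k1.
    by apply: is_derive_eq; rewrite add0r mul1r [_%:A]mulr1.
  by apply: is_derive_eq.
apply/funext => h; rewrite /loglik fct_sumE/=; congr (_ - _).
  rewrite /k0 /k1 mulrDl !mulr_suml addrACA -!big_split/=.
  by congr (_ + _); apply: eq_bigr => i _; rewrite !mxE; ring.
by apply: eq_bigr => i _; rewrite fct_sumE.
Qed.

(** Since [J] is open and there are finitely many sums, small moves along [(u, v)] keep them all in
    [J]. *)
Lemma dloglik_le0 (J : set R) r c a b u v :
  open J -> J `<=` (Theta mu)^° -> (forall i j, J (a 0 i + b 0 j)) ->
  (forall a' b', (forall i j, J (a' 0 i + b' 0 j)) ->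
    loglik mu r c a' b' <= loglik mu r c a b) ->
  dloglik r c a b u v <= 0.
Proof.
move=> oJ JT Jab ab_max.
have near_J (ij : 'I_m * 'I_n) : \forall h \near (0 : R),
    J ((a + h *: u) 0 ij.1 + (b + h *: v) 0 ij.2).
  case: ij => i j /=.
  have c0 : {for (0 : R), continuous
      (fun h : R => (a 0 i + h * u 0 i) + (b 0 j + h * v 0 j))}.
    by apply: cvgD; apply: cvgD; (try exact: cvg_cst); apply: cvgM;
      (exact: cvg_id || exact: cvg_cst).
  have : nbhs (a 0 i + 0 * u 0 i + (b 0 j + 0 * v 0 j)) J.
    by rewrite !mul0r !addr0; apply: open_nbhs_nbhs; split.
  by move=> /c0; apply: (@filterS _ (nbhs (0 : R))) => h /=; rewrite !mxE.
have : nbhs (0 : R) [set h | forall ij : 'I_m * 'I_n,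
    J ((a + h *: u) 0 ij.1 + (b + h *: v) 0 ij.2)] .
  apply: (@filter_forall R ('I_m * 'I_n)%type (fun ij => [set h | J ((a + h *:
    u) 0 ij.1 + (b + h *: v) 0 ij.2)]) (nbhs (0 : R))).
  exact: near_J.
move=> /nbhs_ballP[e/= e0 Je].
have ab : dual_admissible mu a b by move=> i j; exact/JT.
apply: (is_derive_le0 (is_derive_loglik r c u v ab) e0) => h /andP[h0 he].
rewrite add0r !scale0r !addr0; apply: ab_max => i j; apply: (Je h _ (i, j)).
by rewrite /ball/= sub0r normrN gtr0_norm.
Qed.

Lemma max_transport (J : set R) r c a b :
  open J -> J `<=` (Theta mu)^° -> (forall i j, J (a 0 i + b 0 j)) ->
  (forall a' b', (forall i j, J (a' 0 i + b' 0 j)) ->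
    loglik mu r c a' b' <= loglik mu r c a b) ->
  transport r c (mean_mx a b).
Proof.
move=> oJ JT Jab ab_max.
have D0 u v : dloglik r c a b u v = 0.
  apply/eqP; rewrite eq_le (dloglik_le0 _ _ oJ JT Jab ab_max)/=.
  by have := dloglik_le0 (- u) (- v) oJ JT Jab ab_max;
    rewrite dloglikN oppr_le0.
have sum_delta k (f : 'I_k -> R) i :
    \sum_j f j * (delta_mx 0 i : 'rV[R]_k) 0 j = f i.
  rewrite (bigD1 i)//= mxE !eqxx mulr1 big1 ?addr0// => j /negbTE ji.
  by rewrite mxE eqxx ji mulr0.
have sum_0 k (f : 'I_k -> R) : \sum_j f j * (0 : 'rV[R]_k) 0 j = 0.
  by rewrite big1// => j _; rewrite mxE mulr0.
split=> [i|j].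
- have := D0 (delta_mx 0 i) 0; rewrite /dloglik sum_delta sum_0 addr0 => /eqP.
  rewrite subr_eq0 => /eqP ->; rewrite exchange_big; apply: eq_bigr => j _.
  under eq_bigr => k _ do rewrite [(0 : 'rV__) 0 j]mxE addr0.
  by rewrite sum_delta mxE.
- have := D0 0 (delta_mx 0 j); rewrite /dloglik sum_delta sum_0 add0r => /eqP.
  rewrite subr_eq0 => /eqP ->; apply: eq_bigr => i _.
  under eq_bigr => k _ do rewrite [(0 : 'rV__) 0 i]mxE add0r.
  by rewrite sum_delta mxE.
Qed.

Lemma MLE_transport r c a b : is_MLE mu r c a b -> transport r c (mean_mx a b).
Proof.
move=> [ab ab_max]; apply: (max_transport (J := (Theta mu)^°)) => //.
exact: open_interior.
Qed.

Hypothesis psi_ge_tangent : forall x y, (Theta mu)^° x -> (Theta mu)^° y ->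
  psi' mu x * (y - x) <= psi mu y - psi mu x.

(** Concavity of the likelihood: with the margins expressed through the table of means, the
    comparison is a tangent inequality for [psi] in each entry. *)
Lemma transport_MLE r c a b : dual_admissible mu a b ->
  transport r c (mean_mx a b) -> is_MLE mu r c a b.
Proof.
move=> ab rcab; split; first exact: ab.
move=> a' b' ab'.
rewrite !(loglik_transport _ _ rcab); apply: ler_sum => i _;
  apply: ler_sum => j _.
have aux (d x y q q' : R) : d * (y - x) <= q' - q -> d * y - q' <= d * x - q by
  lra.
by rewrite mean_mxE; apply: aux; exact: psi_ge_tangent (ab i j) (ab' i j).
Qed.

Hypothesis ltr_psi' : forall x y, (Theta mu)^° x -> (Theta mu)^° y -> x < y ->
  psi' mu x < psi' mu y.

(** Each [t i j] is the difference of the means times the difference of the sums. The total is zero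
    because both tables have the same margins, whereas strict monotonicity of [psi'] makes each term
    positive unless the sums agree. *)
Lemma transport_dual_unique r c a b a' b' :
  dual_admissible mu a b -> dual_admissible mu a' b' ->
  transport r c (mean_mx a b) -> transport r c (mean_mx a' b') ->
  forall i j, a 0 i + b 0 j = a' 0 i + b' 0 j.
Proof.
move=> ab ab' rc rc'.
pose t i j := (psi' mu (a 0 i + b 0 j) - psi' mu (a' 0 i + b' 0 j)) *
  (a 0 i + b 0 j - (a' 0 i + b' 0 j)).
have t_gt0 i j : a 0 i + b 0 j != a' 0 i + b' 0 j -> 0 < t i j.
  move=> /lt_total/orP[lt|lt].
    have H := ltr_psi' (ab i j) (ab' i j) lt.
    by rewrite /t nmulr_rgt0 subr_lt0.
  have H := ltr_psi' (ab' i j) (ab i j) lt.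
  by rewrite /t mulr_gt0 ?subr_gt0.
have t_ge0 i j : 0 <= t i j.
  have [e|/t_gt0/ltW//] := eqVneq (a 0 i + b 0 j) (a' 0 i + b' 0 j).
  by rewrite /t e subrr mul0r.
have [X [XE rcX]] : exists X : 'M[R]_(m, n),
    (forall i j, X i j = psi' mu (a 0 i + b 0 j)) /\ transport r c X.
  by exists (mean_mx a b); split; [move=> i j; rewrite mean_mxE|exact: rc].
have [X' [XE' rcX']] : exists X : 'M[R]_(m, n),
    (forall i j, X i j = psi' mu (a' 0 i + b' 0 j)) /\ transport r c X.
  by exists (mean_mx a' b'); split; [move=> i j; rewrite mean_mxE|exact: rc'].
have : \sum_i \sum_j t i j = 0.
  have tE i j : t i j = X i j * ((a - a') 0 i + (b - b') 0 j)
     - X' i j * ((a - a') 0 i + (b - b') 0 j).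
    rewrite /t -XE -XE' -mulrBl; congr (_ * _).
    by rewrite !mxE; ring.
  under eq_bigr do (under eq_bigr do rewrite tE; rewrite sumrB).
  by rewrite sumrB (transport_pairing _ _ rcX) (transport_pairing _ _ rcX')
    subrr.
move=> /psumr_eq0P t0 i j; apply/eqP; apply: contraT => /t_gt0.
have /psumr_eq0P -> // : \sum_j t i j = 0 by apply: t0 => // k _;
  exact: sumr_ge0.
by rewrite ltxx.
Qed.

End likelihood.

(** * Consequences of the standing assumptions *)

Lemma linear_growth (R : realFieldType) (k l u v w x : R) : 0 < k -> k <= l ->
  u <= v -> w - u = l * (x + (v - u) / k - x) -> v <= w.
Proof.
move=> k0 kl uv; rewrite addrAC subrr add0r => e.
rewrite -(lerD2r (- u)) e -[leLHS](divfK (x := k)) ?gt_eqF// mulrC.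
by rewrite ler_wpM2r// divr_ge0 ?subr_ge0// ltW.
Qed.

Lemma ler_extrapolation (R : realDomainType) (u v : R) : u <= v ->
  [/\ 3 * u - 2 * v <= 2 * u - v, 3 * u - 2 * v <= u & v <= 2 * v - u].
Proof. by move=> uv; split; lra. Qed.

Lemma ler_midpoint (R : realFieldType) (y z v : R) : y <= v -> v < 2 * z - y ->
  exists x, [/\ v = x + x - y, y <= x & x < z].
Proof. by move=> yv vz; exists ((v + y) / 2); split; lra. Qed.

(** The two kinds of rows in the counterexample: a corner mean [u] with [k] entries [p], and one
    entry [p] with [k] entries [s]. The slack [t - p], taken [k] times, absorbs the excess of [u]
    over [t]. *)
Lemma ler_weighted_mean (R : realDomainType) (k s t u p : R) :
  0 <= k -> s <= t -> s <= u -> s <= p -> p <= t -> `|u - t| <= k * (t - p) ->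
  (s * (k + 1) <= u + k * p /\ u + k * p <= t * (k + 1)) /\
  (s * (k + 1) <= p + k * s /\ p + k * s <= t * (k + 1)).
Proof.
move=> k0 st su sp pt /(le_trans (ler_norm _)) ut.
have kst := ler_wpM2l k0 st; have ksp := ler_wpM2l k0 sp.
by rewrite !mulrDr !mulr1 ![_ * k]mulrC; lra.
Qed.

Lemma cvg_sum_fin (R : realType) (J : finType) (T : Type) (F : set_system T)
    {FF : Filter F} (f : J -> T -> R) (l : J -> R) :
  (forall i, f i t @[t --> F] --> l i) ->
  (\sum_i f i t) @[t --> F] --> \sum_i l i.
Proof.
move=> fl; elim: (index_enum J) => [|i s ih].
  by rewrite big_nil; under eq_fun do rewrite big_nil; exact: cvg_cst.
rewrite big_cons; under eq_fun do rewrite big_cons.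
by apply: cvgD => //; exact: fl.
Qed.

Lemma ler_sum_entry (R : numDomainType) (I J : finType) (g : I -> J -> R) k l :
  (forall i j, 0 <= g i j) -> g k l <= \sum_i \sum_j g i j.
Proof.
move=> g0; rewrite (bigD1 k)//= (bigD1 l)//= -addrA lerDl.
by apply: addr_ge0; apply: sumr_ge0 => // i _; exact: sumr_ge0.
Qed.

Lemma ler_deviation (R : realDomainType) (q p w x0 x t : R) :
  x0 <= t -> t <= x -> q <= p -> p <= w ->
  - (`|q - w| * `|x - x0|) <= (p - w) * (t - x0).
Proof.
move=> x0t tx qp pw.
rewrite (@ler0_norm _ (q - w)) ?subr_le0 ?(le_trans qp)//.
rewrite ger0_norm ?subr_ge0 ?(le_trans x0t)// mulNr opprK.
apply: (@le_trans _ _ ((q - w) * (t - x0))).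
  by rewrite ler_wnM2l ?lerD2r// subr_le0 (le_trans qp).
by rewrite ler_wpM2r ?lerD2r// subr_ge0.
Qed.

Lemma ler_deviationN (R : realDomainType) (q p w x0 x t : R) :
  t <= x0 -> x <= t -> p <= q -> w <= p ->
  - (`|q - w| * `|x - x0|) <= (p - w) * (t - x0).
Proof.
move=> tx0 xt pq wp.
have := @ler_deviation R (- q) (- p) (- w) (- x0) (- x) (- t).
by rewrite !lerN2 -!opprD !normrN mulrNN; apply.
Qed.

Lemma itv_subr (R : numDomainType) (lo hi p q u : R) :
  lo <= p + u <= hi -> lo <= q + u <= hi -> - (hi - lo) <= p - q <= hi - lo.
Proof.
move=> /andP[lp ph] /andP[lq qh].
have -> : p - q = p + u - (q + u) by ring.
by rewrite opprB !lerB.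
Qed.

Lemma itv_conv (R : realDomainType) (lo hi x y h : R) :
  lo <= x <= hi -> lo <= y <= hi -> 0 <= h <= 1 ->
  lo <= (1 - h) * y + h * x <= hi.
Proof. by move=> /andP[? ?] /andP[? ?] /andP[? ?]; apply/andP; split; nra. Qed.

Section regular.
Variables (R : realType) (mu : borel_measure R).
Implicit Types (x y z s t C : R).
Hypothesis Theta_neq0 : Theta mu !=set0.
Hypothesis Theta_neq1 : forall theta : R, Theta mu <> [set theta].
Hypothesis psi''_gt0 : forall x : R, (Theta mu)^° x -> 0 < psi'' mu x.
Hypothesis psi'_bij : set_bij (Theta mu)^° (mean_domain mu) (psi' mu).

Lemma interior_Theta_neq0 : exists x : R, (Theta mu)^° x.
Proof.
have [x Tx] := Theta_neq0.
have [y [Ty yx]] : exists y, Theta mu y /\ y <> x.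
  apply: contrapT => H; apply: (Theta_neq1 (theta := x)); apply/seteqP;
    split => [y Ty|_ ->//].
  by apply: contrapT => yx; apply: H; exists y.
have [xy|xy|xy] := ltgtP x y; last by exfalso; apply: yx.
- exists ((x + y) / 2); apply: (Theta_interior Tx Ty); lra.
- exists ((x + y) / 2); apply: (Theta_interior Ty Tx); lra.
Qed.

Lemma psi'_mean x : (Theta mu)^° x -> mean_domain mu (psi' mu x).
Proof. by have [h _ _] := psi'_bij; exact: h. Qed.

Lemma phiP s : mean_domain mu s ->
  (Theta mu)^° (phi mu s) /\ psi' mu (phi mu s) = s.
Proof.
move=> ms; have [_ _ surj] := psi'_bij; split.
  by have [h _ _] := bijpinv_bij (fun=> 0) psi'_bij; exact: h.
by apply: (surjpK (fun=> 0) surj); rewrite inE.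
Qed.

Lemma msupp_neq0 : msupp mu !=set0.
Proof.
have [x Ix] := interior_Theta_neq0; have [] := psi'_mean Ix.
move=> /ereal_inf_lt[_ [y sy _]] _; by exists y.
Qed.

Lemma is_derive_psi x : (Theta mu)^° x -> is_derive x 1 (psi mu) (psi' mu x).
Proof.
move=> Ix; apply: DeriveDef; first exact: derivable_psi msupp_neq0 Ix.
by rewrite /psi' derive1E.
Qed.

Lemma is_derive_psi' x : (Theta mu)^° x ->
  is_derive x 1 (psi' mu) (psi'' mu x).
Proof.
move=> Ix; apply: DeriveDef; last by rewrite -derive1E.
(* Derivability of [psi'] is read off from [psi'' > 0], the derivative being 0 by convention where
   it does not exist. *)
by apply: derivable_of_derive1_neq0; rewrite gt_eqF//; exact: psi''_gt0.
Qed.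

Lemma ltr_psi' x y : (Theta mu)^° x -> (Theta mu)^° y -> x < y ->
  psi' mu x < psi' mu y.
Proof. exact: (ltr_p1 (@interior_Theta_itv R mu) is_derive_psi' psi''_gt0). Qed.

Lemma ler_psi' x y : (Theta mu)^° x -> (Theta mu)^° y ->
  (psi' mu x <= psi' mu y) = (x <= y).
Proof. exact: (ler_p1 (@interior_Theta_itv R mu) is_derive_psi' psi''_gt0). Qed.

Lemma ler_phi s t : mean_domain mu s -> mean_domain mu t ->
  (phi mu s <= phi mu t) = (s <= t).
Proof.
move=> ms mt; have [Is es] := phiP ms; have [It et] := phiP mt.
by rewrite -(ler_psi' Is It) es et.
Qed.

Lemma psi_ge_tangent x y : (Theta mu)^° x -> (Theta mu)^° y ->
  psi' mu x * (y - x) <= psi mu y - psi mu x.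
Proof.
exact: (p_ge_tangent (@interior_Theta_itv R mu) is_derive_psi is_derive_psi'
  psi''_gt0).
Qed.

Lemma log_convexP (f : R -> R) (D : set R) : log_convex_on D f ->
  forall (x y t : R), D x -> D y -> 0 <= t <= 1 ->
  ln (f (t * x + (1 - t) * y)) <= t * ln (f x) + (1 - t) * ln (f y).
Proof.
move=> [_ cf] x y t Dx Dy /andP[t0 t1].
by have := cf (Itv01 t0 t1) x y; rewrite !inE => /(_ Dx Dy); rewrite convRE.
Qed.

(* If [B] were finite, the interior of Theta would be unbounded above, and
   [psi'] would grow at least linearly on it. *)
Lemma suppB_pinfty : (forall x y : R, (Theta mu)^° x -> (Theta mu)^° y ->
  x <= y -> psi'' mu x <= psi'' mu y) -> suppB mu = +oo%E.
Proof.
move=> ndecr; have [x0 I0] := interior_Theta_neq0.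
case E : (suppB mu) => [B|//|]; last by have [_] := psi'_mean I0; rewrite E.
have [_] := psi'_mean I0; rewrite E lte_fin => psi'B.
(* Rising with slope at least [psi'' mu x0], the mean would have reached [B] at [y]. *)
pose y := x0 + (B - psi' mu x0) / psi'' mu x0.
have k0 : 0 < psi'' mu x0 by exact: psi''_gt0.
have x0y : x0 <= y by rewrite lerDl divr_ge0// ltW// subr_gt0.
have sB : (suppB mu <= B%:E)%E by rewrite E.
have Iy : (Theta mu)^° y by exact: interior_Theta_up sB I0 x0y.
have [c [x0c cy H]] := MVT_itv (@interior_Theta_itv R mu) is_derive_psi' I0 Iy
  x0y.
have Ic : (Theta mu)^° c by apply: (interior_Theta_itv I0 Iy); rewrite x0c.
have [_] := psi'_mean Iy; rewrite E lte_fin ltNge => /negP; case.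
exact: (linear_growth k0 (ndecr _ _ I0 Ic x0c) (ltW psi'B) H).
Qed.

Hypothesis suppB_infty : suppB mu = +oo%E.

(** Means are unbounded above, so choose [y] with mean at least [w + k]; the second argument of the
    maximum keeps [y] at distance at least [e / 2] from [x0], and [k * (e / 2) > C]. *)
Lemma psi'_grows_up x0 w C : (Theta mu)^° x0 -> 0 <= C ->
  exists y : R, [/\ (Theta mu)^° y, x0 < y & C < (psi' mu y - w) * (y - x0)].
Proof.
move=> I0 C0; have /interior_Theta[e e0 [_ Te]] := I0.
have I1 : (Theta mu)^° (x0 + e / 2).
  have /interior_Theta[e' e'0 [Te' _]] := I0; apply: (Theta_interior Te' Te);
    lra.
pose k := C / (e / 2) + 1.
have mK : mean_domain mu (Num.max (w + k) (psi' mu (x0 + e / 2))).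
  split; last by rewrite suppB_infty ltry.
  have [h _] := psi'_mean I1; apply: lt_le_trans h _.
  by rewrite lee_fin le_max lexx orbT.
have [IK eK] := phiP mK; set y := phi mu _ in IK eK; exists y.
have ey : x0 + e / 2 <= y by rewrite -(ler_psi' I1 IK) eK le_max lexx orbT.
split=> //; first by lra.
have k0 : 0 < k by rewrite ltr_wpDl// divr_ge0//; lra.
apply: (@lt_le_trans _ _ (k * (e / 2))).
  by rewrite mulrDl mul1r divfK ?lt0r_neq0 ?divr_gt0// ltrDl divr_gt0.
apply: ler_pM; [exact: ltW|by lra| |by lra].
by rewrite lerBrDl eK le_max lexx.
Qed.

Lemma psi'_grows_down x0 w C : (Theta mu)^° x0 -> mean_domain mu w -> 0 <= C ->
  exists y : R, [/\ (Theta mu)^° y, y < x0 & C < (psi' mu y - w) * (y - x0)].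
Proof.
move=> I0 [Aw wB] C0; have /interior_Theta[e e0 [Te Te2]] := I0.
have I1 : (Theta mu)^° (x0 - e / 2) by apply: (Theta_interior Te Te2); lra.
suff [y [Iy yx0 H]] : exists y : R,
    [/\ (Theta mu)^° y, y < x0 & C < (w - psi' mu y) * (x0 - y)].
  by exists y; split=> //; rewrite -mulrNN !opprB.
case E : (suppA mu) => [A||]; last 2 first.
- by move: Aw; rewrite E.
- pose k := C / (e / 2) + 1.
  have mK : mean_domain mu (Num.min (w - k) (psi' mu (x0 - e / 2))).
    split; first by rewrite E ltNyr.
    by rewrite suppB_infty ltry.
  have [IK eK] := phiP mK; set y := phi mu _ in IK eK; exists y.
  have ey : y <= x0 - e / 2 by rewrite -(ler_psi' IK I1) eK ge_min lexx orbT.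
  split=> //; first by lra.
  have k0 : 0 < k by rewrite ltr_wpDl// divr_ge0//; lra.
  apply: (@lt_le_trans _ _ (k * (e / 2))).
    by rewrite mulrDl mul1r divfK ?lt0r_neq0 ?divr_gt0// ltrDl divr_gt0.
  apply: ler_pM; [exact: ltW|by lra| |by lra].
  by rewrite lerBrDl addrC -lerBrDl eK ge_min lexx.
(* For finite [A] the means are bounded below, but so is not Theta: keep [w - psi' mu y] at least
   [d], half the distance from [A] to [w], and take [y] far to the left. *)
- have sA : (A%:E <= suppA mu)%E by rewrite E.
  rewrite E lte_fin in Aw.
  have mw' : mean_domain mu ((A + w) / 2).
    by split; [rewrite E lte_fin; lra|rewrite suppB_infty ltry].
  have [I' e'] := phiP mw'; pose d := (w - A) / 2.
  have d_le q : q <= (A + w) / 2 -> d <= w - q by rewrite /d; lra.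
  have d0 : 0 < d by rewrite /d; lra.
  have Cd0 : 0 <= C / d by rewrite divr_ge0// ltW.
  pose y := Num.min x0 (phi mu ((A + w) / 2)) - (1 + C / d).
  have y1 : y <= x0 - (1 + C / d) by rewrite lerD2r ge_min lexx.
  have y2 : y <= phi mu ((A + w) / 2).
    have : y <= phi mu ((A + w) / 2) - (1 + C / d).
      by rewrite lerD2r ge_min lexx orbT.
    by lra.
  have Iy : (Theta mu)^° y by apply: interior_Theta_down sA I0 _; lra.
  exists y; split=> //; first by lra.
  have : psi' mu y <= (A + w) / 2 by rewrite -e' (ler_psi' Iy I').
  move=> le_mid; apply: (@lt_le_trans _ _ (d * (1 + C / d))).
    by rewrite mulrDr mulr1 mulrC divfK ?gt_eqF// ltrDr.
  apply: ler_pM; [exact: ltW|exact: addr_ge0| |by rewrite lerBrDr addrC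
    -lerBrDr].
  exact: d_le le_mid.
Qed.

(** * Existence of the MLE *)

(** The product can be negative only when [theta] lies between [x0] and [phi mu w]; there each
    factor is bounded by its size at one of these two ends. *)
Lemma psi'_deviation_ge theta x0 w : (Theta mu)^° theta -> (Theta mu)^° x0 ->
  mean_domain mu w ->
  - (`|psi' mu x0 - w| * `|phi mu w - x0|) <=
  (psi' mu theta - w) * (theta - x0).
Proof.
move=> It I0 mw; have [Iw ew] := phiP mw.
have n0 : - (`|psi' mu x0 - w| * `|phi mu w - x0|) <= 0.
  by rewrite oppr_le0 mulr_ge0.
have [t0|/ltW t0] := leP x0 theta.
- have [tw|/ltW tw] := leP w (psi' mu theta).
    by apply: le_trans n0 _; rewrite mulr_ge0 ?subr_ge0.
  have tx : theta <= phi mu w by rewrite -(ler_psi' It Iw) ew.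
  have p0 : psi' mu x0 <= psi' mu theta by rewrite ler_psi'.
  exact: (ler_deviation t0 tx p0 tw).
- have [tw|/ltW tw] := leP (psi' mu theta) w.
    by apply: le_trans n0 _; rewrite mulr_le0 ?subr_le0.
  have tx : phi mu w <= theta by rewrite -(ler_psi' Iw It) ew.
  have p0 : psi' mu theta <= psi' mu x0 by rewrite ler_psi'.
  exact: (ler_deviationN t0 tx p0 tw).
Qed.

Section table.
Variables (m n : nat) (r : 'rV[R]_m) (c : 'rV[R]_n) (X : 'M[R]_(m, n)).
Hypotheses (m_gt0 : (0 < m)%N) (n_gt0 : (0 < n)%N).
Hypothesis rcX : transport r c X.
Hypothesis mean_X : forall i j, mean_domain mu (X i j).

Let box (lo hi : R) : set ('rV[R]_m * 'rV[R]_n) :=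
  [set v : 'rV[R]_m * 'rV[R]_n | forall i j, lo <= v.1 0 i + v.2 0 j <= hi].

Let dual_sum_continuous i j :
  continuous (fun v : 'rV[R]_m * 'rV[R]_n => v.1 0 i + v.2 0 j).
Proof.
move=> v; apply: cvgD.
- exact: (cvg_comp fst (fun w : 'rV[R]_m => w 0 i) cvg_fst
    (@coord_continuous _ _ _ _ _ v.1)).
- exact: (cvg_comp snd (fun w : 'rV[R]_n => w 0 j) cvg_snd
    (@coord_continuous _ _ _ _ _ v.2)).
Qed.

Lemma loglik_continuous (v : 'rV[R]_m * 'rV[R]_n) :
  dual_admissible mu v.1 v.2 ->
  {for v, continuous (fun w => loglik mu r c w.1 w.2)}.
Proof.
move=> adm; rewrite /prop_for /continuous_at.
rewrite (loglik_transport _ _ _ rcX).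
under eq_fun do rewrite (loglik_transport _ _ _ rcX).
apply: cvg_sum_fin => i; apply: cvg_sum_fin => j; apply: cvgB.
  by apply: cvgM; [exact: cvg_cst|exact: dual_sum_continuous].
apply: (cvg_comp (fun w : 'rV[R]_m * 'rV[R]_n => w.1 0 i + w.2 0 j) (psi mu)
  (@dual_sum_continuous i j v)).
have [dpsi _] := is_derive_psi (adm i j).
exact/differentiable_continuous/derivable1_diffP.
Qed.

(* The objective is unchanged under (a + k, b - k), so a maximizer on the
   compact slice a 0 i0 = 0 maximizes over the whole box. *)
Lemma loglik_box_max lo hi : lo <= hi ->
  (Theta mu)^° lo -> (Theta mu)^° hi ->
  exists a b, box lo hi (a, b) /\
    forall a' b', box lo hi (a', b') ->
      loglik mu r c a' b' <= loglik mu r c a b.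
Proof.
move=> lohi Ilo Ihi; pose i0 := Ordinal m_gt0; pose j0 := Ordinal n_gt0.
pose L := hi - lo.
(* Box points normalized by [a 0 i0 = 0] obey these bounds: each [b 0 j] is then one of the sums,
   and each [a 0 i] a difference of two sums. *)
pose K := ([set u : 'rV[R]_m | forall i, `[- L, L]%classic (u ord0 i)] `*`
   [set w : 'rV[R]_n | forall j, `[lo, hi]%classic (w ord0 j)]) `&` box lo hi.
have cK : compact K.
  apply: compact_closedI.
    apply: compact_setX; apply: (@rV_compact R _ (fun _ => `[_, _]%classic)) =>
      i; exact: segment_compact.
  rewrite (_ : box lo hi = \bigcap_(ij in [set: 'I_m * 'I_n])
     (fun v : 'rV[R]_m * 'rV[R]_n => v.1 0 ij.1 + v.2 0 ij.2) @^-1` `[lo,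
       hi]%classic).
    apply: closed_bigI => -[i j] _; apply: preimage_closed;
      last exact: itv_closed.
    by move=> v _; exact: dual_sum_continuous.
  apply/seteqP; split=> [v bv [i j] _|v bv i j] /=; first by rewrite in_itv/=;
    exact: bv.
  by have := bv (i, j) I; rewrite /= in_itv.
have K0 : K !=set0.
  exists (0, const_mx lo); split; [split=> /= [i|j]|move=> i j];
    rewrite /= ?mxE ?in_itv/=.
  - by rewrite oppr_le0 /L subr_ge0 lohi.
  - by rewrite lexx.
  - by rewrite add0r lexx.
have fK : {within K, continuous (fun v => loglik mu r c v.1 v.2)}.
  apply: continuous_in_subspaceT => v; rewrite inE => -[_ bv].
  apply: loglik_continuous => i j; exact: (interior_Theta_itv Ilo Ihi (bv i j)).
have [[a b]] := compact_EVT_max K0 cK fK.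
rewrite inE => -[_ bab] ab_max; exists a, b; split; first exact: bab.
move=> a' b' bab'.
pose k := a' 0 i0.
have adj : loglik mu r c a' b' =
    loglik mu r c (a' - const_mx k) (b' + const_mx k).
  rewrite !(loglik_transport _ _ _ rcX); apply: eq_bigr => i _;
    apply: eq_bigr => j _.
  by rewrite !mxE (_ : a' 0 i - k + (b' 0 j + k) = a' 0 i + b' 0 j)//; ring.
rewrite adj; apply: (ab_max (a' - const_mx k, b' + const_mx k)); rewrite inE.
split; [split=> /= [i|j]|move=> i j]; rewrite /= ?mxE ?in_itv/=.
- exact: itv_subr (bab' i j0) (bab' i0 j0).
- by have := bab' i0 j; rewrite /= /k addrC.
- by rewrite (_ : _ + _ = a' 0 i + b' 0 j); [exact: bab'|ring].
Qed.

(** The sum is the derivative of the likelihood from the maximizer towards a point whose sums all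
    equal [x0]; the segment stays in the box by convexity. *)
Lemma mean_deviation_sum_le0 lo hi a b x0 : lo <= x0 <= hi ->
  (Theta mu)^° lo -> (Theta mu)^° hi -> box lo hi (a, b) ->
  (forall a' b', box lo hi (a', b') ->
    loglik mu r c a' b' <= loglik mu r c a b) ->
  \sum_i \sum_j (psi' mu (a 0 i + b 0 j) - X i j) * (a 0 i + b 0 j - x0) <= 0.
Proof.
move=> x0_itv Ilo Ihi bab ab_max.
have adm : dual_admissible mu a b.
  by move=> i j; exact: (interior_Theta_itv Ilo Ihi (bab i j)).
pose v := const_mx x0 - b.
have -> : \sum_i \sum_j (psi' mu (a 0 i + b 0 j) - X i j) * (a 0 i + b 0 j - x0)
    = dloglik mu r c a b (- a) v.
  rewrite /dloglik -(transport_pairing _ _ rcX) -sumrB; apply: eq_bigr => i _.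
  by rewrite -sumrB; apply: eq_bigr => j _; rewrite !mxE; ring.
apply: (is_derive_le0 (is_derive_loglik is_derive_psi r c (- a) v adm) ltr01).
move=> h /andP[h0 h1]; rewrite add0r !scale0r !addr0; apply: ab_max => i j /=.
have -> : (a + h *: - a) 0 i + (b + h *: v) 0 j =
    (1 - h) * (a 0 i + b 0 j) + h * x0 by rewrite !mxE; ring.
by apply: itv_conv x0_itv (bab i j) _; rewrite !ltW.
Qed.

(* Let (a, b) maximize over the box [lo <= a i + b j <= hi]. Moving towards the
   constant table x0 does not increase the likelihood, so each term of
   [mean_deviation_sum_le0] is at most the sum Ct of the opposites of the lower
   bounds of all terms; lo and hi are chosen so that a term at the boundary of
   the box would exceed Ct. Hence the maximizer is interior. *)
Lemma MLE_exists : exists a b, is_MLE mu r c a b.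
Proof.
have [x0 I0] := interior_Theta_neq0.
pose C i j := `|psi' mu x0 - X i j| * `|phi mu (X i j) - x0|.
have C0 i j : 0 <= C i j by rewrite mulr_ge0.
pose Ct := \sum_i \sum_j C i j.
have Ct0 : 0 <= Ct by apply: sumr_ge0 => i _; exact: sumr_ge0.
pose ij0 := (Ordinal m_gt0, Ordinal n_gt0).
pose XX (ij : 'I_m * 'I_n) := X ij.1 ij.2.
have [kmax _ X_max] := arg_maxP XX (erefl : xpredT ij0).
have [kmin _ X_min] := arg_minP XX (erefl : xpredT ij0).
have [hi [Ihi x0hi hiC]] := psi'_grows_up (XX kmax) I0 Ct0.
have [lo [Ilo lox0 loC]] := psi'_grows_down I0 (mean_X kmin.1 kmin.2) Ct0.
have lohi : lo <= hi by rewrite ltW// (lt_trans lox0).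
have [a [b [bab ab_max]]] := loglik_box_max lohi Ilo Ihi.
have x0_itv : lo <= x0 <= hi by rewrite !ltW.
have sum_le0 := mean_deviation_sum_le0 x0_itv Ilo Ihi bab ab_max.
have adm : dual_admissible mu a b.
  by move=> i j; exact: (interior_Theta_itv Ilo Ihi (bab i j)).
pose t i j := (psi' mu (a 0 i + b 0 j) - X i j) * (a 0 i + b 0 j - x0).
have tC i j : t i j <= Ct.
  (* Adding [C k l] makes every term nonnegative, so a single one is at most the total. *)
  have tC0 k l : 0 <= t k l + C k l.
    by rewrite -(opprK (C k l)) subr_ge0; exact: psi'_deviation_ge.
  apply: (@le_trans _ _ (t i j + C i j)); first by rewrite lerDl.
  apply: (le_trans (ler_sum_entry i j tC0)).
  under eq_bigr do rewrite big_split/=.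
  by rewrite big_split/= gerDr.
have ne_hi i j : a 0 i + b 0 j != hi.
  apply/eqP => e; have := tC i j; rewrite /t e leNgt => /negP; apply.
  apply: lt_le_trans hiC _; rewrite ler_wpM2r ?subr_ge0 ?(ltW x0hi)//.
  by rewrite lerD2l lerN2; exact: X_max (i, j) isT.
have ne_lo i j : a 0 i + b 0 j != lo.
  apply/eqP => e; have := tC i j; rewrite /t e leNgt => /negP; apply.
  apply: lt_le_trans loC _; rewrite ler_wnM2r ?subr_le0 ?(ltW lox0)//.
  by rewrite lerD2l lerN2; exact: X_min (i, j) isT.
have strict i j : `]lo, hi[%classic (a 0 i + b 0 j).
  rewrite /= in_itv/= !lt_neqAle ne_hi [_ == _]eq_sym ne_lo.
  exact: bab i j.
have JT : `]lo, hi[%classic `<=` (Theta mu)^°.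
  by move=> x; rewrite /= in_itv/= => /andP[? ?];
    apply: (interior_Theta_itv Ilo Ihi); rewrite !ltW.
exists a, b; apply: (transport_MLE psi_ge_tangent adm).
apply: (max_transport is_derive_psi (itv_open lo hi) JT strict) => a' b' Jab'.
apply: ab_max => i j; have := Jab' i j; rewrite /= in_itv/= => /andP[? ?].
by rewrite !ltW.
Qed.

End table.
(** * Tameness *)

Lemma tame_delta p q : mean_domain mu p -> exists2 delta : R, 0 < delta &
  (A_ mu delta <= p%:E)%E /\ (q%:E <= B_ mu delta)%E.
Proof.
(* The bound [delta^-1 >= k] clears both [p] and [q] in absolute value, and [delta <= d0] leaves
   room above [A]. *)
move=> [Ap _]; pose k := 1 + `|p| + `|q|.
have k0 : 0 < k by rewrite /k -addrA ltr_pwDl// addr_ge0.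
have [d0 [d00 Ad0]] : exists d0 : R, 0 < d0 /\
    forall d, d <= d0 -> (suppA mu + d%:E <= p%:E)%E.
  case E : (suppA mu) Ap => [A| |] Ap; last 2 first.
  - by [].
  - by exists 1; split=> // d _; rewrite addNye leNye.
  - rewrite lte_fin in Ap; exists (p - A); split; first by rewrite subr_gt0.
    by move=> d; rewrite -EFinD lee_fin lerBrDl.
exists (Num.min d0 k^-1); first by rewrite lt_min d00 invr_gt0.
set delta := Num.min d0 k^-1.
have delta0 : 0 < delta by rewrite lt_min d00 invr_gt0.
have k_le : k <= delta^-1.
  by rewrite -[k]invrK lef_pV2 ?posrE ?invr_gt0// ge_min lexx orbT.
split; rewrite /A_ /B_.
- rewrite ge_max Ad0 ?ge_min ?lexx//= lee_fin lerNl; apply: le_trans k_le.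
  by rewrite /k (le_trans (ler_norm _))// normrN addrAC lerDr addr_ge0.
- rewrite suppB_infty addye// le_min leey/= lee_fin; apply: le_trans k_le.
  by rewrite /k (le_trans (ler_norm _))// lerDr addr_ge0.
Qed.

Hypothesis psi''_logconvex : log_convex_on (Theta mu)^° (psi'' mu).

Lemma Omega_of_phi_bounds s t :
  mean_domain mu s -> mean_domain mu t -> s <= t ->
  (phiA mu < (3 * phi mu s - 2 * phi mu t)%:E)%E ->
  ((2 * phi mu t - phi mu s)%:E < phiB mu)%E -> Omega mu (s, t).
Proof.
move=> ms mt st Al uB.
have [Is es] := phiP ms; have [It et] := phiP mt.
have phi_st : phi mu s <= phi mu t by rewrite ler_phi.
have [_ phis_B] := phi_interior_Theta Is;
  have [A_phit _] := phi_interior_Theta It.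
have [l_ge l_le u_ge] := ler_extrapolation phi_st.
(* The hypotheses place both extrapolated parameters in the interior of Theta; their means fix
   [delta] before any margin is given. *)
have Il : (Theta mu)^° (3 * phi mu s - 2 * phi mu t).
  by apply: (interior_Theta_phi Al); apply: le_lt_trans phis_B; rewrite lee_fin.
have Iu : (Theta mu)^° (2 * phi mu t - phi mu s).
  by apply: (interior_Theta_phi _ uB); apply: lt_le_trans A_phit _;
    rewrite lee_fin.
have [delta d0 [Ad Bd]] := @tame_delta _ (psi' mu (2 * phi mu t - phi mu s))
  (psi'_mean Il).
split; [exact: ms|exact: mt|exact: st|exists delta; first exact: d0].
move=> m n r c m0 n0 [X [rcX mX]] /= row col.
have [a [b ab_MLE]] := MLE_exists m0 n0 rcX mX.
exists a, b; split; first exact: ab_MLE.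
move=> i j; have [adm _] := ab_MLE.
have [rsum csum] := MLE_transport is_derive_psi ab_MLE.
have bounds := @entry_bounds _ _ _ _ (@interior_Theta_itv R mu) is_derive_psi'
  psi''_gt0 (log_convexP psi''_logconvex) m n (a 0) (b 0) _ _ m0 n0 Is It
    phi_st adm.
have /andP[th_ge th_le] :
    2 * phi mu s - phi mu t <= a 0 i + b 0 j <= 2 * phi mu t - phi mu s.
  apply: bounds => [i'|j'].
  - have [s_le le_t] := row i'; have n0' : 0 < n%:R :> R by rewrite ltr0n.
    under eq_bigr do rewrite -mean_mxE.
    by rewrite rsum es et mulrC -ler_pdivlMr// s_le mulrC -ler_pdivrMr.
  - have [s_le le_t] := col j'; have m0' : 0 < m%:R :> R by rewrite ltr0n.
    under eq_bigr do rewrite -mean_mxE.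
    by rewrite csum es et mulrC -ler_pdivlMr// s_le mulrC -ler_pdivrMr.
split.
- apply: le_trans Ad _; rewrite lee_fin (ler_psi' Il (adm i j)).
  exact: le_trans l_ge th_ge.
- by apply: le_trans Bd; rewrite lee_fin (ler_psi' (adm i j) Iu).
Qed.

(** * Square tables whose margins are not tame for a given delta *)

Lemma not_Omega_of_phi_gt s t :
  mean_domain mu s -> mean_domain mu t -> s <= t ->
  (phiB mu < (2 * phi mu t - phi mu s)%:E)%E -> ~ Omega mu (s, t).
Proof.
move=> ms mt st; have := phiP ms; have := phiP mt.
move: (phi mu s) (phi mu t) => y z [Iz ez] [Iy ey] Bu [_ _ _ [delta d0 /= H]].
(* The corner mean: above [delta^-1], hence beyond [B_ mu delta], and above [s], hence in the domain
   of means. *)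
pose K := Num.max delta^-1 s + 1.
have sK : s < K by rewrite /K ltr_pwDr// le_max lexx orbT.
have dK : delta^-1 < K by rewrite /K ltr_pwDr// le_max lexx.
have mK : mean_domain mu K.
  split; last by rewrite suppB_infty ltry.
  by have [h _] := ms; apply: lt_le_trans h _; rewrite lee_fin ltW.
have [v [Iv ev]] : exists v : R, (Theta mu)^° v /\ psi' mu v = K.
  by exists (phi mu K); exact: phiP.
have [_ vB] := phi_interior_Theta Iv.
have v_lt : v < 2 * z - y by rewrite -lte_fin; exact: lt_trans vB Bu.
have y_v : y <= v by rewrite -(ler_psi' Iy Iv) ey ev ltW.
(* The midpoint [x] of [v] and [y] is below [z], so its mean stays below [t] although the corner
   mean is [K]. *)
have [x [xE yx xz]] := ler_midpoint y_v v_lt.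
have Ix : (Theta mu)^° x by apply: (interior_Theta_itv Iy Iz); rewrite yx ltW.
have px_t : psi' mu x < t by rewrite -ez; exact: ltr_psi'.
have s_px : s <= psi' mu x by rewrite -ey (ler_psi' Iy Ix).
have d_gt0 : 0 < t - psi' mu x by rewrite subr_gt0.
(* In the first row, the slack [t - psi' mu x] of the [k] other entries outweighs the excess of [K]
   over [t]. *)
pose k := Num.bound (`|K - t| / (t - psi' mu x)); pose N := k.+1.
have Kk : `|K - t| <= k%:R * (t - psi' mu x).
  by rewrite -ler_pdivrMr// ltW// archi_boundP// divr_ge0// ltW.
pose f (i j : 'I_N) : R :=
  if i == ord0 then (if j == ord0 then K else psi' mu x)
  else (if j == ord0 then psi' mu x else s).
pose a := \row_(i < N) (if i == ord0 then x else y).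
pose b := \row_(j < N) (if j == ord0 then x - y else 0).
have thetaE i j : a 0 i + b 0 j =
  if i == ord0 then (if j == ord0 then v else x)
  else (if j == ord0 then x else y).
  rewrite !mxE; case: (i == ord0); case: (j == ord0); rewrite ?addr0//;
    last by rewrite addrC subrK.
  by rewrite xE; ring.
have fE i j : psi' mu (a 0 i + b 0 j) = f i j.
  by rewrite thetaE /f; case: ifP => _; case: ifP => _.
have fC i j : f i j = f j i by rewrite /f; case: ifP => _; case: ifP.
have adm : dual_admissible mu a b.
  by move=> i j; rewrite thetaE; case: ifP => _; case: ifP.
pose r := \row_i \sum_j f i j.
have rc : transport r r (mean_mx mu a b).
  split=> [i|j]; rewrite mxE; apply: eq_bigr => l _; rewrite mean_mxE fE//.
have r_bounds i : s <= r 0 i / N%:R /\ r 0 i / N%:R <= t.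
  have N0 : 0 < N%:R :> R by rewrite ltr0n.
  rewrite ler_pdivlMr// ler_pdivrMr// mxE big_ord_recl.
  have -> : \sum_(j < k) f i (lift ord0 j) = k%:R * (if i == ord0 then psi' mu
    x else s).
    by rewrite mulr_natl -[X in _ *+ X]card_ord -sumr_const; apply: eq_bigr.
  have -> : N%:R = k%:R + 1 :> R by rewrite -natr1.
  have [row0 rowS] := ler_weighted_mean (ler0n R k) st (ltW sK) s_px (ltW px_t)
    Kk.
  by rewrite /f eqxx; case: ifP => _; [case: row0|case: rowS].
have [|a' [b' [ab'_MLE bd]]] := H N N r r isT isT _ r_bounds r_bounds.
  exists (mean_mx mu a b); split; first exact: rc.
  by move=> i j; rewrite mean_mxE; exact: psi'_mean.
have [adm' _] := ab'_MLE.
have rc' := MLE_transport is_derive_psi ab'_MLE.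
(* The margins determine the sums of dual parameters, so the tame MLE also has corner mean [K],
   against [delta^-1 < K]. *)
have := transport_dual_unique ltr_psi' adm adm' rc rc' ord0 ord0.
have [_] := bd ord0 ord0 => /[swap] <-; rewrite thetaE eqxx ev /B_ le_min =>
  /andP[_].
by rewrite lee_fin leNgt dK.
Qed.

End regular.

Unset Implicit Arguments.

Theorem theorem1p22 (R : realType) (mu : borel_measure R)
    (Theta_neq0 : Theta mu !=set0)
    (Theta_neq1 : forall theta : R, Theta mu <> [set theta])
    (psi''_gt0 : forall x : R, (Theta mu)^° x -> 0 < psi'' mu x)
    (psi'_bij : set_bij (Theta mu)^° (mean_domain mu) (psi' mu))
    (psi''_ndecr : forall x y : R, (Theta mu)^° x -> (Theta mu)^° y ->
       x <= y -> psi'' mu x <= psi'' mu y)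
    (psi''_logconvex : log_convex_on (Theta mu)^° (psi'' mu)) :
  suppB mu = +oo%E /\
  forall s t : R, mean_domain mu s -> mean_domain mu t -> s <= t ->
    ((phiA mu < (3 * phi mu s - 2 * phi mu t)%:E)%E ->
     ((2 * phi mu t - phi mu s)%:E < phiB mu)%E ->
     Omega mu (s, t)) /\
    (phiA mu = -oo%E ->
     (phiB mu < (2 * phi mu t - phi mu s)%:E)%E ->
     ~ Omega mu (s, t)).
Proof.
have sB := suppB_pinfty Theta_neq0 Theta_neq1 psi''_gt0 psi'_bij psi''_ndecr.
split=> // s t ms mt st; split=> [Al uB|_ Bu].
- exact: (Omega_of_phi_bounds Theta_neq0 Theta_neq1 psi''_gt0 psi'_bij sB
    psi''_logconvex).
- exact: (not_Omega_of_phi_gt Theta_neq0 Theta_neq1 psi''_gt0 psi'_bij sB).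
Qed.
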